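(* Let $n,b$ be natural numbers with $1<n<b$, let $k\ge 0$, let $\sigma$ be a permutation of $\{0,1,\ldots,k\}$ of order $|\sigma|$, let $\psi$ be the $(k+1)$-cycle $(0,1,2,\ldots,k)$, let $(d_k,d_{k-1},\ldots,d_0)_b$ be an $(n,b,\sigma)$-permutiple, and let $c_j$ be its $j$th carry. Then \[ d_j=\frac{1}{n^{|\sigma|}-1}\sum_{\ell=0}^{|\sigma|-1}\left(b\,c_{\psi\sigma^{\ell}(j)}-c_{\sigma^{\ell}(j)}\right)n^{\ell} \] and \[ c_j=\frac{1}{b^{k+1}-1}\sum_{\ell=0}^{k}\left(n\,d_{\sigma\psi^{\ell}(j)}-d_{\psi^{\ell}(j)}\right)b^{\ell} \] for all $0\le j\le k$.
   Context: For integers $0\le d_j<b$, $(d_k,d_{k-1},\ldots,d_0)_b$ denotes the natural number $\sum_{j=0}^k d_j b^j$ (leading zeros are allowed). For a permutation $\sigma$ of $\{0,1,\ldots,k\}$, $(d_k,\ldots,d_0)_b$ is an $(n,b,\sigma)$-permutiple if $(d_k,d_{k-1},\ldots,d_0)_b = n\,(d_{\sigma(k)},d_{\sigma(k-1)},\ldots,d_{\sigma(0)})_b$. Its carries are those of the usual single-digit multiplication of $(d_{\sigma(k)},\ldots,d_{\sigma(0)})_b$ by $n$ in base $b$: $c_0=0$ and $c_{j+1}=\left[n d_{\sigma(j)}+c_j-\lambda(n d_{\sigma(j)}+c_j)\right]/b$ for $0\le j\le k$, where $\lambda(x)$ is the least non-negative residue of $x$ modulo $b$. Since the product has $k+1$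 digits, $c_{k+1}=0$. The cycle $\psi$ satisfies $\psi(j)=j+1$ for $j<k$ and $\psi(k)=0$. Products of permutations are compositions, applied right to left. *)

(* Defs.v *)
From mathcomp Require Import all_boot all_order all_fingroup all_algebra.

Set Implicit Arguments.
Unset Strict Implicit.
Unset Printing Implicit Defensive.

(* Digits are indexed from the least significant one: d j multiplies b ^ j. *)
Definition numeral (b k : nat) (d : 'I_k.+1 -> nat) : nat :=
  \sum_(j < k.+1) d j * b ^ j.

Definition permutiple (n b k : nat) (sigma : {perm 'I_k.+1})
    (d : 'I_k.+1 -> nat) : Prop :=
  (forall j, d j < b) /\
  numeral b d = n * numeral b (fun j => d (sigma j)).

(* Carries of the multiplication by n of the number with digits e.  The index
   ranges over nat because the recursion produces c_0, ..., c_(k+1); for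
   i <= k, inord i is i itself, and the values beyond k+1 are irrelevant. The
   natural subtraction and division below are both exact. *)
Fixpoint mul_carry (n b k : nat) (e : 'I_k.+1 -> nat) (j : nat) : nat :=
  if j is i.+1 then
    let x := n * e (inord i) + mul_carry n b e i in (x - x %% b) %/ b
  else 0.

Definition carry (n b k : nat) (sigma : {perm 'I_k.+1})
    (d : 'I_k.+1 -> nat) : nat -> nat :=
  mul_carry n b (fun j => d (sigma j)).

(* ordS j is j + 1 modulo k + 1. *)
Definition psi (k : nat) : {perm 'I_k.+1} := perm (@ordS_inj k.+1).

(* Main.v *)
Require Import Defs.
From mathcomp Require Import all_boot all_order all_fingroup all_algebra.
Import GRing.Theory.

(** Write c for the carries. A single step of the multiplication reads
    [n * d (sigma j) + c j = b * c (j + 1) + r j], where [r j] is the digit it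
    outputs. The outputs [r] together with the final carry, and the digits [d]
    together with a final carry [0], represent the same number in base b; by
    uniqueness of the expansion [r = d] and the final carry vanishes. As the
    first carry vanishes too, [j + 1] may be replaced by [psi j] ([permutiple_carry]).
    Hence, for every j,
        [b * c (psi j) - c j = n * d (sigma j) - d j].
    Along the sigma-orbit of j this is a linear recurrence for d with ratio n
    and inhomogeneous term given by the carries; along the psi-orbit it is one
    for c with ratio b and inhomogeneous term given by the digits. Since both
    orbits close up, each recurrence is solved by one telescoping geometric
    sum ([perm_recurrence_sol]), and these solutions are the two formulas. *)

Local Open Scope nat_scope.

(** Including a leading term [u * b ^ m], not bounded by b, makes the induction
    on the lowest digit go through and also identifies the final carry. *)
Lemma base_expansion_uniq b m (f g : 'I_m -> nat) u v :
    (forall i, f i < b) -> (forall i, g i < b) ->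
    \sum_(i < m) f i * b ^ i + u * b ^ m = \sum_(i < m) g i * b ^ i + v * b ^ m ->
  f =1 g /\ u = v.
Proof.
elim: m f g => [|m IHm] f g fb gb.
  by rewrite !big_ord0 !add0n !muln1 => ->; split=> [[]|].
have shift (h : 'I_m.+1 -> nat) w : \sum_(i < m.+1) h i * b ^ i + w * b ^ m.+1
    = (\sum_(i < m) h (lift ord0 i) * b ^ i + w * b ^ m) * b + h ord0.
  rewrite big_ord_recl muln1 !mulnDl big_distrl /= expnSr mulnA -addnA addnC.
  by congr (_ + _ + _); apply: eq_bigr => i _; rewrite expnSr mulnA.
rewrite !shift => E; have b_gt0: 0 < b by apply: leq_ltn_trans (fb ord0).
have E0: f ord0 = g ord0.
  by have /(congr1 (modn^~ b)) := E; rewrite !modnMDl !modn_small.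
move: E; rewrite E0 => /addIn/eqP; rewrite eqn_pmul2r // => /eqP.
case/IHm=> // Efg Euv; split=> // i.
by case: (unliftP ord0 i) => [i'|] ->.
Qed.

Lemma mul_carryS n b k (e : 'I_k.+1 -> nat) i :
  mul_carry n b e i.+1 = (n * e (inord i) + mul_carry n b e i) %/ b.
Proof.
rewrite /=; set x := _ + _; case: (posnP b) => [->|b_gt0]; first by rewrite !divn0.
by rewrite {1}(divn_eq x b) addnK mulnK.
Qed.

(** Schoolbook multiplication stopped after m steps: each step splits its
    partial result x into the output [x %% b] and the carry [x %/ b], so no
    value is lost. *)
Lemma mul_carry_invariant n b k (e : 'I_k.+1 -> nat) m :
  n * \sum_(0 <= i < m) e (inord i) * b ^ i =
  \sum_(0 <= i < m) ((n * e (inord i) + mul_carry n b e i) %% b) * b ^ i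
    + mul_carry n b e m * b ^ m.
Proof.
elim: m => [|m IHm]; first by rewrite !big_geq // muln0.
rewrite !big_nat_recr //= -/(mul_carry n b e m.+1) mulnDr IHm mul_carryS expnS.
rewrite -!addnA; congr (_ + _); rewrite !mulnA -!mulnDl; congr (_ * _).
by rewrite addnC [RHS]addnC -divn_eq.
Qed.

(** The successor of the top index under psi is 0, where the carry is 0; the
    relation holds there because the product has no extra digit. *)
Lemma permutiple_carry n b k (sigma : {perm 'I_k.+1}) (d : 'I_k.+1 -> nat) j :
    permutiple n b sigma d ->
  n * d (sigma j) + carry n b sigma d j = b * carry n b sigma d (psi k j) + d j.
Proof.
case=> db num_d; have b_gt0: 0 < b by apply: leq_ltn_trans (db j).
set c := carry n b sigma d.
pose r (i : 'I_k.+1) := (n * d (sigma i) + c i) %% b.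
have [dr c_top]: d =1 r /\ 0 = c k.+1.
  apply: (base_expansion_uniq b) => // [i|]; first exact: ltn_pmod.
  rewrite mul0n addn0 [LHS]num_d /numeral.
  have := mul_carry_invariant n b k (fun i => d (sigma i)) k.+1.
  rewrite -/c !big_mkord => inv.
  under eq_bigr => i _ do rewrite -[i in sigma i]inord_val.
  by rewrite inv; congr (_ + _); apply: eq_bigr => i _; rewrite inord_val.
have cS: c (psi k j) = c j.+1.
  rewrite permE /=; have [jk | jk] := ltnP j k; first by rewrite modn_small.
  have -> : j = k :> nat by apply/eqP; rewrite eqn_leq jk -ltnS ltn_ord.
  by rewrite modnn -c_top.
by rewrite cS [d j in RHS]dr /r /c /carry mul_carryS inord_val [b * _]mulnC -divn_eq.
Qed.

Lemma psiX_val k l (j : 'I_k.+1) : (psi k ^+ l)%g j = (j + l) %% k.+1 :> nat.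
Proof.
rewrite permX; elim: l => [|l IHl] /=; first by rewrite addn0 modn_small.
by rewrite permE /= IHl -addn1 modnDml addn1 addnS.
Qed.

Lemma psiX_card k : (psi k ^+ k.+1)%g = 1%g.
Proof.
by apply/permP=> j; apply/val_inj; rewrite /= psiX_val perm1 modnDr modn_small.
Qed.

Local Open Scope ring_scope.

(** On a cycle of length dividing N, weighting the differences [x F (s y) - F y]
    by the powers of x makes them telescope to [x ^+ N F j - F j]. *)
Lemma perm_recurrence_sol (K : fieldType) (T : finType) (s : {perm T}) N
    (x : K) (F : T -> K) j :
    (s ^+ N)%g = 1%g -> x ^+ N != 1 ->
  F j = 1 / (x ^+ N - 1) *
    \sum_(l < N) (x * F (s ((s ^+ l)%g j)) - F ((s ^+ l)%g j)) * x ^+ l.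
Proof.
move=> sN xN; pose G l := F ((s ^+ l)%g j) * x ^+ l.
have -> : \sum_(l < N) (x * F (s ((s ^+ l)%g j)) - F ((s ^+ l)%g j)) * x ^+ l
    = G N - G 0%N.
  rewrite -telescope_sumr // big_mkord; apply: eq_bigr => l _.
  by rewrite /G expgSr permM mulrBl exprS mulrCA mulrA.
rewrite /G sN expg0 perm1 expr0 -mulrBr mulrCA mul1r mulVf ?mulr1 //.
by rewrite subr_eq0.
Qed.

Lemma natrX_neq1 (m N : nat) : (1 < m)%N -> (0 < N)%N -> m%:R ^+ N != 1 :> rat.
Proof.
move=> m1 N_gt0; rewrite -natrX Num.Theory.pnatr_eq1.
by rewrite -(expn0 m) eqn_exp2l // -lt0n.
Qed.

Theorem theorem4 (n b k : nat) (sigma : {perm 'I_k.+1}) (d : 'I_k.+1 -> nat)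
    (hn : (1 < n)%N) (hnb : (n < b)%N) (hd : permutiple n b sigma d) :
  let c := carry n b sigma d in
  forall j : 'I_k.+1,
    (d j)%:R = 1 / (n%:R ^+ #[sigma]%g - 1) *
      \sum_(l < #[sigma]%g)
        (b%:R * (c (psi k ((sigma ^+ l)%g j)))%:R
         - (c ((sigma ^+ l)%g j))%:R) * n%:R ^+ l :> rat
    /\
    (c j)%:R = 1 / (b%:R ^+ k.+1 - 1) *
      \sum_(l < k.+1)
        (n%:R * (d (sigma ((psi k ^+ l)%g j)))%:R
         - (d ((psi k ^+ l)%g j))%:R) * b%:R ^+ l :> rat.
Proof.
move=> c j.
have rel i : b%:R * (c (psi k i))%:R - (c i)%:R
    = n%:R * (d (sigma i))%:R - (d i)%:R :> rat.
  apply/eqP; rewrite subr_eq addrAC eq_sym subr_eq -!natrM -!natrD.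
  by rewrite (permutiple_carry _ _ _ _ _ i hd).
(* In each sum the summand is rewritten so that only the family being solved
   for occurs in it; the sum then telescopes. *)
split.
  under eq_bigr => l _ do rewrite rel.
  apply: (perm_recurrence_sol _ _ _ _ _ (fun i => (d i)%:R)); first exact: expg_order.
  by rewrite natrX_neq1 ?order_gt0.
under eq_bigr => l _ do rewrite -rel.
apply: (perm_recurrence_sol _ _ _ _ _ (fun i : 'I_k.+1 => (c i)%:R)); first exact: psiX_card.
by rewrite natrX_neq1 // (ltn_trans hn).
Qed.
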